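(* Consider the delayed projected stochastic gradient iteration $x(t+1)=\Pi_{\mathcal S}[x(t)-\eta(t)g(t)]$ described in the context, and suppose that the Assumptions on Objective Functions, on Gradient Estimators (with bias sequence $\{q(t)\}$), and on Communication Delay (with constants $C$ and $\kappa$) stated in the context hold. For $t\in\{0,1,2,\dots\}$ define the projected gradient $$h(t):=\frac{1}{\eta(t)}\left(x(t)-\Pi_{\mathcal S}[x(t)-\eta(t)\nabla f(x(t))]\right).$$ Let the (positive) step size sequence $\{\eta(t)\}_{t\ge 0}$ be a decreasing sequence such that $\lim_{t\to\infty}\frac{\eta(\lceil\kappa t\rceil)}{\eta(t)}=\bar\eta$ for some constant $\bar\eta>0$, and $\sum_{t=0}^\infty\eta(t)=\infty$. Then, as $T\to\infty$, $$\frac{1}{T+1}\sum_{t=0}^{T}\mathbb E[\|h(t)\|^2]=\mathcal O\left(\frac{\sum_{t=0}^T\left(\eta(t)+\eta^2(t)+\eta(t)q^2(t)\right)}{T\,\eta(T)}\right).$$ In particular, for $\eta(t)=\frac{\eta_0}{(t+1)^\alpha}$ for some constant $\eta_0>0$ and $\alpha\in(0,1)$, and any non-increasing $\{q(t)\}$, we have $\frac{1}{T+1}\sum_{t=0}^{T}\mathbb E[\|h(t)\|^2]=\mathcal O(1)$.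
   Context: Setting. Let $\mathcal S\subset\mathbb R^d$ be a closed convex set, $n\ge 1$, $f_i:\mathcal S\to\mathbb R$ for $i\in[n]=\{1,\dots,n\}$, and $f=\sum_{i=1}^n f_i$; the goal is to minimize $f$ over $\mathcal S$. $\|\cdot\|$ is the Euclidean norm and $\Pi_{\mathcal S}:\mathbb R^d\to\mathcal S$ is the Euclidean projection onto $\mathcal S$. A server maintains $x(t)\in\mathcal S$, $t\in\{0,1,2,\dots\}$, with $x(0)=x_0\in\mathcal S$ arbitrary. At each time $t$ it sends $x(t)$ to all agents. Agent $i$ can return a stochastic gradient estimate $g_i(x(t),\xi(t))\in\mathbb R^d$, depending on $x(t)$ and a random variable $\xi(t)$ independent of $x(t)$. Let $\tau_i(t)\le t$ be the (random) time stamp of the latest gradient information from agent $i$ available to the server at time $t$, i.e. this information is $g_i(x(\tau_i(t)),\xi(\tau_i(t)))$; if nothing has been received from agent $i$, then $\tau_i(t)=-1$ and this term is $0$. The server forms $g(t)=\sum_{i=1}^n g_i(x(\tau_i(t)),\xi(\tau_i(t)))$ and updates $x(t+1)=\Pi_{\mathcal S}[x(t)-\eta(t)g(t)]$ with step sizes $\eta(t)>0$. Assumption on Objective Functions. $f^*:=\inf_{x\in\mathcal S}f(x)>-\infty$, $f$ is continuously differentiable, and each $f_i$ is $L$-smooth: $\|\nabla f_i(x)-\nabla f_i(y)\|\le L\|x-y\|$ for all $x,y\in\mathcal S$. Assumption on Gradient Estimators. Let $\tilde g_i(t):=\mathbb E[g_i(x(t),\xi(t))\mid\sigma(x(t))]$,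 where $\sigma(x(t))$ is the $\sigma$-algebra generated by $x(t)$. There is $G\in(0,\infty)$ such that for all $t$ and all $i\in[n]$, $\mathbb E[\|g_i(x(t),\xi(t))\|^2\mid\sigma(x(t))]\le G$. For all $t_1,t_2\in\{0,1,2,\dots\}$, $\|\tilde g_i(t_1)-\tilde g_i(t_2)\|\le L\|x(t_1)-x(t_2)\|$. Finally $\|\tilde g_i(t)-\nabla f_i(x(t))\|\le q(t)$ for a non-negative (deterministic) sequence $\{q(t)\}_{t\ge0}$, called the gradient estimator bias. Assumption on Communication Delay. The delays $t-\tau_i(t)$ are independent across time and agents. There is $0<C<\infty$ such that $\mathbb E[(t-\tau_i(t))^2]\le C$ for all $t\in\{0,1,2,\dots\}$ and $i\in[n]$. There is $\kappa\in(0,1)$ such that $t-\tau_i(t)\le(1-\kappa)t$, i.e. $\tau_i(t)\ge\kappa t$, for all $t$ and $i$. *)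

(* Defs.v *)
(* MathComp + MathComp-Analysis. *)
From HB Require Import structures.
From mathcomp Require Import all_boot all_order all_algebra.
From mathcomp Require Import all_classical all_reals all_analysis.

Set Implicit Arguments.
Unset Strict Implicit.
Unset Printing Implicit Defensive.

Import Order.TTheory GRing.Theory Num.Theory.
Import numFieldNormedType.Exports.

Local Open Scope classical_set_scope.
Local Open Scope ring_scope.

Section euclidean.
Context {R : realType} {d : nat}.
Implicit Types (u v x : 'rV[R]_d) (S : set 'rV[R]_d).

Definition dotv u v : R := \sum_(j < d) u 0 j * v 0 j.

(* The library norm `|v| on row vectors is the sup norm, hence a separate
   Euclidean norm. *)
Definition enorm v : R := Num.sqrt (dotv v v).

(* When S is nonempty, closed and convex, exactly one point satisfies the
   predicate; otherwise the value is the default 0. *)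
Definition proj S (z : 'rV[R]_d) : 'rV[R]_d :=
  xget 0 [set p | S p /\ forall y, S y -> enorm (z - p) <= enorm (z - y)].

(* v is a gradient at x of the restriction of f to S:
   f y = f x + <v, y - x> + o(y - x) as y tends to x inside S.  Values of f
   outside S are irrelevant.  If S has empty interior v need not be unique, so
   gradients are passed as explicit vector fields. *)
Definition is_gradient_on S (f : 'rV[R]_d -> R) x v : Prop :=
  (fun y => f y - f x - dotv v (y - x) : R^o)
    =o_ (within S (nbhs x)) (fun y => y - x).

Definition projected_gradient S (gradf : 'rV[R]_d -> 'rV[R]_d) (eta : R) x :=
  eta^-1 *: (x - proj S (x - eta *: gradf x)).

End euclidean.

Notation borelV R d := (g_sigma_algebraType (@open 'rV[R]_d)).

Section probability_notions.
Context {R : realType} {dO : measure_display} {Omega : measurableType dO}.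
Variable P : probability Omega R.

Local Open Scope ereal_scope.

(* Z is a version of the conditional expectation of Y given the
   sub-sigma-algebra F. *)
Definition is_cond_exp (F : set_system Omega) (Y Z : Omega -> R) : Prop :=
  [/\ P.-integrable setT (EFin \o Y),
      P.-integrable setT (EFin \o Z),
      forall B : set R, measurable B -> F (Z @^-1` B) &
      forall A, F A -> \int[P]_(w in A) (Z w)%:E = \int[P]_(w in A) (Y w)%:E].

Definition is_cond_expV d (F : set_system Omega) (Y Z : Omega -> 'rV[R]_d) :=
  forall j : 'I_d, is_cond_exp F (fun w => Y w ord0 j) (fun w => Z w ord0 j).

Definition indep_RV d1 d2 (T1 : measurableType d1) (T2 : measurableType d2)
    (X : Omega -> T1) (Y : Omega -> T2) : Prop :=
  forall A B, measurable A -> measurable B ->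
    P (X @^-1` A `&` Y @^-1` B) = P (X @^-1` A) * P (Y @^-1` B).

Definition mutually_indep_RV (I : eqType) (X : I -> Omega -> R) : Prop :=
  forall (s : seq I) (B : I -> set R), uniq s ->
    (forall k, measurable (B k)) ->
    P (\big[setI/setT]_(k <- s) X k @^-1` B k) =
      \prod_(k <- s) P (X k @^-1` B k).

End probability_notions.

(* u = O(v) for an extended-real sequence u: u is eventually finite, so that
   `fine` does not discard the value +oo. *)
Definition ebigO {R : realType} (u : nat -> \bar R) (v : nat -> R) : Prop :=
  (\forall t \near \oo, u t \is a fin_num) /\
  (fun t => (fine (u t) : R^o)) =O_\oo (fun t => (v t : R^o)).

Section delayed_sgd.
Context {R : realType} {d n : nat}.
Context {dO : measure_display} {Omega : measurableType dO}.
Context {dX : measure_display} {Xi : measurableType dX}.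
Variables (P : probability Omega R) (S : set 'rV[R]_d).
Implicit Types (x : nat -> Omega -> 'rV[R]_d) (xi : nat -> Omega -> Xi).
Implicit Types (tau : 'I_n -> nat -> Omega -> int).
Implicit Types (g : 'I_n -> 'rV[R]_d -> Xi -> 'rV[R]_d).

(* Time stamps are integers; only -1 among the negative ones is allowed below,
   and it means that nothing has been received yet. *)
Definition delayed_term g x xi (s : int) (i : 'I_n) (w : Omega) : 'rV[R]_d :=
  if s is Posz k then g i (x k w) (xi k w) else 0.

Definition aggregate g x xi tau (t : nat) (w : Omega) : 'rV[R]_d :=
  \sum_(i < n) delayed_term g x xi (tau i t w) i w.

Definition delay tau (i : 'I_n) (t : nat) (w : Omega) : R :=
  t%:R - (tau i t w)%:~R.

Record delayed_projected_sgd (x0 : 'rV[R]_d) (eta : nat -> R) g x xi tau :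
    Prop := {
  sgd_x_measurable : forall t, measurable_fun setT (x t : Omega -> borelV R d);
  sgd_xi_measurable : forall t, measurable_fun setT (xi t);
  sgd_xi_indep : forall t, indep_RV P (x t : Omega -> borelV R d) (xi t);
  sgd_delay_measurable : forall i t, measurable_fun setT (delay tau i t);
  sgd_stamp_range : forall i t w, (-1 <= tau i t w <= t%:Z)%R;
  sgd_init : S x0 /\ forall w, x 0%N w = x0;
  sgd_step : forall t w,
    x t.+1 w = proj S (x t w - eta t *: aggregate g x xi tau t w) }.

Record objective_assumption (f : 'I_n -> 'rV[R]_d -> R)
    (gradfi : 'I_n -> 'rV[R]_d -> 'rV[R]_d)
    (gradf : 'rV[R]_d -> 'rV[R]_d) (L : R) : Prop := {
  obj_bounded_below :
    (-oo < ereal_inf [set (\sum_(i < n) f i y)%:E | y in S])%E;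
  obj_gradient : forall y, S y ->
    is_gradient_on S (fun z => \sum_(i < n) f i z) y (gradf y);
  obj_C1 : {within S, continuous gradf};
  obj_gradients : forall i y, S y -> is_gradient_on S (f i) y (gradfi i y);
  obj_smooth : forall i y z, S y -> S z ->
    enorm (gradfi i y - gradfi i z) <= L * enorm (y - z) }.

Definition sigma_of (X : Omega -> 'rV[R]_d) : set_system Omega :=
  g_sigma_algebra_preimage (X : Omega -> borelV R d).

(* Measurability and integrability of g_i(x(t), xi(t)) are part of
   `is_cond_exp`; m i t is the conditional second moment. *)
Record estimator_assumption g x xi
    (gtilde : 'I_n -> nat -> Omega -> 'rV[R]_d)
    (m : 'I_n -> nat -> Omega -> R)
    (gradfi : 'I_n -> 'rV[R]_d -> 'rV[R]_d) (L G : R) (q : nat -> R) :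
    Prop := {
  est_mean : forall i t, is_cond_expV P (sigma_of (x t))
    (fun w => g i (x t w) (xi t w)) (gtilde i t);
  est_second_moment : forall i t, is_cond_exp P (sigma_of (x t))
    (fun w => enorm (g i (x t w) (xi t w)) ^+ 2) (m i t);
  est_bound_pos : 0 < G;
  est_bound : forall i t, {ae P, forall w, m i t w <= G};
  est_lipschitz : forall i t1 t2, {ae P, forall w,
    enorm (gtilde i t1 w - gtilde i t2 w) <= L * enorm (x t1 w - x t2 w)};
  est_bias_ge0 : forall t, 0 <= q t;
  est_bias : forall i t, {ae P, forall w,
    enorm (gtilde i t w - gradfi i (x t w)) <= q t} }.

Record delay_assumption tau (C kappa : R) : Prop := {
  del_indep : mutually_indep_RV P (fun k : 'I_n * nat => delay tau k.1 k.2);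
  del_moment_pos : 0 < C;
  del_moment : forall i t, ('E_P[fun w => (delay tau i t w ^+ 2)%R] <= C%:E)%E;
  del_kappa : 0 < kappa < 1;
  del_stamp : forall i t, {ae P, forall w,
    delay tau i t w <= (1 - kappa) * t%:R} }.

(* The left-hand side of the estimate:
   (T+1)^{-1} sum_{t <= T} E ||h(t)||^2. *)
Definition mean_sq_projected_gradient (gradf : 'rV[R]_d -> 'rV[R]_d)
    (eta : nat -> R) x (T : nat) : \bar R :=
  ((T.+1%:R^-1)%:E * \sum_(0 <= t < T.+1)
     'E_P[fun w => (enorm (projected_gradient S gradf (eta t) (x t w)) ^+ 2)%R])%E.

End delayed_sgd.

(* Main.v *)
(* Since eta is nonincreasing, the right-hand side of the estimate is at least
   1/(T eta(T)) times eta(T) sum_(t <= T) (1 + q(t)^2), so it suffices to show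
   E ||h(t)||^2 <= K (1 + q(t)^2) for a constant K; no descent argument is
   needed.  As x(t) lies in S, the minimality of the projection gives
   ||h(t)|| <= 2 ||v|| for any gradient v of f at x(t), in particular for
   v = sum_i grad f_i(x(t)).  Each summand is within q(t) of the conditional
   mean of g_i, whose coordinates are bounded by 1 + G almost surely by the
   second-moment bound: testing the conditional expectation Z of Y on
   {s Z > c}, where s = 1 or s = -1, and using 2 c s Y <= Y^2 + c^2 shows that
   this event is negligible as soon as c^2 > G. *)
Require Import Defs.
From HB Require Import structures.
From mathcomp Require Import all_boot all_order all_algebra.
From mathcomp Require Import all_classical all_reals all_analysis.
From mathcomp Require Import measurable_realfun ring lra.
Import Order.TTheory GRing.Theory Num.Theory.
Import numFieldNormedType.Exports.
Local Open Scope classical_set_scope.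
Local Open Scope ring_scope.

(** * Inner product and Euclidean norm *)

Section euclidean_lemmas.
Context {R : realType} {d : nat}.
Implicit Types (u v w x y z p : 'rV[R]_d) (S : set 'rV[R]_d).

Lemma dotvC u v : dotv u v = dotv v u.
Proof. by apply: eq_bigr => j _; rewrite mulrC. Qed.

Lemma dotvDl u v w : dotv (u + v) w = dotv u w + dotv v w.
Proof. by rewrite -big_split; apply: eq_bigr => j _; rewrite mxE mulrDl. Qed.

Lemma dotvZl a u w : dotv (a *: u) w = a * dotv u w.
Proof. by rewrite mulr_sumr; apply: eq_bigr => j _; rewrite mxE mulrA. Qed.

Lemma dotvNl u w : dotv (- u) w = - dotv u w.
Proof. by rewrite -scaleN1r dotvZl mulN1r. Qed.

Lemma dotvBl u v w : dotv (u - v) w = dotv u w - dotv v w.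
Proof. by rewrite dotvDl dotvNl. Qed.

Lemma dotvDr u v w : dotv w (u + v) = dotv w u + dotv w v.
Proof. by rewrite !(dotvC w) dotvDl. Qed.

Lemma dotvZr a u w : dotv w (a *: u) = a * dotv w u.
Proof. by rewrite !(dotvC w) dotvZl. Qed.

Lemma dotvNr u w : dotv w (- u) = - dotv w u.
Proof. by rewrite !(dotvC w) dotvNl. Qed.

Lemma dotvBr u v w : dotv w (u - v) = dotv w u - dotv w v.
Proof. by rewrite !(dotvC w) dotvBl. Qed.

Lemma dotv_suml (I : Type) (r : seq I) (F : I -> 'rV[R]_d) w :
  dotv (\sum_(i <- r) F i) w = \sum_(i <- r) dotv (F i) w.
Proof.
apply: (big_morph (dotv^~ w)) => [u v|]; first exact: dotvDl.
by rewrite -[0](scale0r 0) dotvZl mul0r.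
Qed.

Lemma dotvv_ge0 u : 0 <= dotv u u.
Proof. by apply: sumr_ge0 => j _; rewrite -expr2 sqr_ge0. Qed.

Lemma sqr_enorm u : enorm u ^+ 2 = dotv u u.
Proof. by rewrite sqr_sqrtr// dotvv_ge0. Qed.

Lemma le_enorm u v : (enorm u <= enorm v) = (dotv u u <= dotv v v).
Proof. by rewrite ler_sqrt// dotvv_ge0. Qed.

Lemma sqr_coord_le u j : u 0 j ^+ 2 <= dotv u u.
Proof.
rewrite /dotv (bigD1 j)//= -expr2 lerDl; apply: sumr_ge0 => k _.
by rewrite -expr2 sqr_ge0.
Qed.

(** Transfers Euclidean bounds to the sup norm, in which boundedness is phrased when compactness is
    derived. *)
Lemma normr_le_enorm u : `|u| <= enorm u.
Proof.
rewrite [`|u|]mx_normrE.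
apply: (big_ind (fun a => a <= enorm u)) => [|a b ua ub|[i j] _ /=].
- exact: sqrtr_ge0.
- by rewrite ge_max ua.
- by rewrite (ord1 i) -sqrtr_sqr ler_sqrt ?dotvv_ge0 ?sqr_coord_le.
Qed.

Lemma dotv_le_mean u v : 2 * dotv u v <= dotv u u + dotv v v.
Proof.
have := dotvv_ge0 (u - v); rewrite dotvBl !dotvBr (dotvC v u) => ?; lra.
Qed.

Lemma dotvvD_le u v :
  dotv (u + v) (u + v) <= 2 * dotv u u + 2 * dotv v v.
Proof.
have := dotv_le_mean u v; rewrite dotvDl !dotvDr (dotvC v u) => ?; lra.
Qed.

(** Cauchy-Schwarz for [n] summands: the square expands into [n ^ 2] products [dotv (F i) (F j)],
    each at most the mean of the two squares. *)
Lemma dotvv_sum_le n (F : 'I_n -> 'rV[R]_d) :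
  dotv (\sum_i F i) (\sum_i F i) <= n%:R * \sum_i dotv (F i) (F i).
Proof.
have -> : n%:R * (\sum_i dotv (F i) (F i)) =
    \sum_i \sum_j 2^-1 * (dotv (F i) (F i) + dotv (F j) (F j)).
  under [RHS]eq_bigr => i _.
    rewrite -mulr_sumr big_split /= sumr_const card_ord; over.
  rewrite -[RHS]mulr_sumr big_split /= sumrMnl sumr_const card_ord -mulr2n.
  by rewrite mulr_natl mulrnAr -[RHS]mulr_natl mulVKf ?pnatr_eq0.
rewrite dotv_suml; apply: ler_sum => i _.
rewrite dotvC dotv_suml; apply: ler_sum => j _.
by have := dotv_le_mean (F j) (F i) => ?; lra.
Qed.

(** * Existence of projections and size of the projected gradient *)

Lemma continuous_enorm_dist z : continuous (fun y => enorm (z - y)).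
Proof.
move=> y; apply: (@continuous_comp _ _ _ (fun y => dotv (z - y) (z - y))
  (@Num.sqrt R)); last exact: sqrt_continuous.
rewrite /dotv; apply: cvg_big => [||j _].
- exact: add_continuous.
- exact: nbhs_filter.
under eq_fun do rewrite !mxE.
have cvg_zj : z 0 j - (M : 'rV[R]_d) 0 j @[M --> y] --> z 0 j - y 0 j.
  exact: (cvgB (cvg_cst _) (@coord_continuous _ _ _ _ _ y)).
by rewrite !mxE; exact: (cvgM cvg_zj cvg_zj).
Qed.

(** The distance to [z] attains its minimum on the compact set [K] of points of [S] no farther from
    [z] than [s], so [xget] never falls back on its default 0. *)
Lemma proj_spec S z : closed S -> S !=set0 ->
  S (Defs.proj S z) /\
  forall y, S y -> enorm (z - Defs.proj S z) <= enorm (z - y).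
Proof.
move=> clS [s Ss].
pose r := enorm (z - s); pose K := S `&` [set y | enorm (z - y) <= r].
have K0 : K !=set0 by exists s; split => //=.
have cK : compact K.
  apply: bounded_closed_compact.
    exists (`|z| + r); split; first exact: num_real.
    move=> M rM y [_ /= yr]; apply: le_trans (ltW rM).
    have -> : y = z - (z - y) by rewrite opprB addrC subrK.
    rewrite (le_trans (ler_normB _ _))// lerD2l.
    exact: le_trans (normr_le_enorm _) yr.
  apply: closedI => //.
  rewrite (_ : [set y | _] = (fun y => enorm (z - y)) @^-1` [set a | a <= r])//.
  apply: preimage_closed; last exact: closed_le.
  by move=> y _; exact: continuous_enorm_dist.
have [p /set_mem[Sp pr] pmin] : exists2 p, p \in K &
    forall y, y \in K -> enorm (z - p) <= enorm (z - y).
  apply: compact_EVT_min => //.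
  by apply: continuous_subspaceT; exact: continuous_enorm_dist.
apply: (xgetPex 0 (P := [set p | S p /\ _])).
exists p; split => // y Sy.
(* Points of [S] outside [K] are farther than [r] from [z], while [p] is within [r]. *)
have [yr|/ltW ry] := leP (enorm (z - y)) r; last exact: le_trans pr ry.
by apply: pmin; rewrite inE.
Qed.

(* Comparing the projection of [x - eta *: v] with the point [x] of [S]
   suffices here: nonexpansiveness would only improve the constant. *)
Lemma projected_gradient_le S (gradf : 'rV[R]_d -> 'rV[R]_d) (eta : R) x :
  closed S -> S x -> 0 < eta ->
  enorm (projected_gradient S gradf eta x) ^+ 2 <=
    4 * dotv (gradf x) (gradf x).
Proof.
move=> clS Sx eta0; rewrite sqr_enorm /projected_gradient.
set z := x - eta *: _.
have [_ /(_ _ Sx)] := proj_spec S z clS (ex_intro _ x Sx).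
set p := Defs.proj S z; rewrite le_enorm => pz.
rewrite dotvZl dotvZr mulrA -invfM -expr2 mulrC ler_pdivrMr ?exprn_gt0//.
(* Both parts have norm at most [eta] times that of the gradient, since [z - p] is no longer than
   [z - x]; this gives the factor 4. *)
have -> : x - p = (z - p) + eta *: gradf x by rewrite addrAC /z subrK.
apply: le_trans (dotvvD_le _ _) _.
move: pz; rewrite (_ : z - x = - (eta *: gradf x)); last first.
  by rewrite /z addrAC subrr add0r.
by rewrite dotvNl dotvNr opprK !dotvZl !dotvZr => ?; lra.
Qed.

(** * Gradients relative to a convex set *)

Lemma is_gradient_on_sum n S (f : 'I_n -> 'rV[R]_d -> R)
    (v : 'I_n -> 'rV[R]_d) x :
  (forall i, is_gradient_on S (f i) x (v i)) ->
  is_gradient_on S (fun y => \sum_i f i y) x (\sum_i v i).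
Proof.
move=> fv; apply/eqoP => e e0.
(* The tolerance is split into [n.+1] shares, so that the divisor is positive even for an empty
   sum. *)
have n0 : 0 < n.+1%:R :> R by rewrite ltr0n.
have en0 : 0 < e / n.+1%:R by rewrite divr_gt0.
have : \forall y \near within S (nbhs x), forall i,
    `|f i y - f i x - dotv (v i) (y - x)| <= e / n.+1%:R * `|y - x|.
  apply: filter_forall => i.
  by have /eqoP := fv i; exact.
apply: filterS => y fvy.
rewrite dotv_suml -!sumrB (le_trans (ler_norm_sum _ _ _))//.
apply: le_trans (ler_sum _ (fun i _ => fvy i)) _.
rewrite sumr_const card_ord -[leLHS]mulr_natl mulrA ler_wpM2r//.
by rewrite mulrCA ger_pMr// ler_pdivrMr// mul1r ler_nat.
Qed.

(** Subtracting the two first-order expansions of [f] shows that [dotv (v - w) (z - x)] is o(|z -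
    x|) on [S]. It is linear along the segment from [x] to [y], which convexity keeps in [S], so it
    vanishes there. *)
Lemma is_gradient_on_orthogonal S (f : 'rV[R]_d -> R) x y v w :
  convex_set (S : set (convex_lmodType 'rV[R]_d)) -> S x -> S y ->
  is_gradient_on S f x v -> is_gradient_on S f x w ->
  dotv (v - w) (y - x) = 0.
Proof.
move=> cS Sx Sy fv fw; apply/eqP; rewrite -normr_le0.
have le_eps e : 0 < e -> `|dotv (v - w) (y - x)| <= 2 * e * `|y - x|.
  move=> e0.
  have near_fv : \forall z \near x, S z ->
      `|f z - f x - dotv v (z - x)| <= e * `|z - x|.
    by have /eqoP := fv; exact.
  have near_fw : \forall z \near x, S z ->
      `|f z - f x - dotv w (z - x)| <= e * `|z - x|.
    by have /eqoP := fw; exact.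
  have near_vw : \forall z \near x, S z ->
      `|dotv (v - w) (z - x)| <= 2 * e * `|z - x|.
    apply: filterS2 near_fv near_fw => z + + Sz => /(_ Sz) vz /(_ Sz) wz.
    have -> : dotv (v - w) (z - x) =
        (f z - f x - dotv w (z - x)) - (f z - f x - dotv v (z - x)).
      by rewrite dotvBl; ring.
    by rewrite (le_trans (ler_normB _ _))//; lra.
  have cvg_x : x + s *: (y - x) @[s --> 0^'+] --> x.
    have : x + s *: (y - x) @[s --> 0^'+] --> x + 0 *: (y - x).
      apply: cvgD; first exact: cvg_cst.
      by apply: cvgZr_tmp; apply: cvg_within; exact: cvg_id.
    by rewrite scale0r addr0.
  (* A point of the segment close enough to [x]; both sides of the bound there scale with [s > 0],
     which cancels. *)
  have [s [s0 [s1]]] :=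
    filter_ex (filterI (nbhs_right_gt 0)
      (filterI (nbhs_right_le ltr01) (cvg_x _ near_vw))).
  rewrite /= addrAC subrr add0r => vws.
  have Ss : S (x + s *: (y - x)).
    have s01 : (0 <= s <= 1) by rewrite (ltW s0).
    have := cS y x (Itv01 (ltW s0) s1) (mem_set Sy) (mem_set Sx).
    rewrite inE /conv /= (_ : x + _ = s *: y + (1 - s) *: x) //.
    by rewrite scalerBl scale1r scalerBr addrCA.
  move: (vws Ss); rewrite dotvZr normrM normrZ (gtr0_norm s0) mulrCA.
  by rewrite ler_pM2l.
have [yx0|yx0] := eqVneq `|y - x| 0.
  by have := le_eps 1 ltr01; rewrite yx0 mulr0.
have {}yx0 : 0 < `|y - x| by rewrite lt_neqAle eq_sym yx0 normr_ge0.
apply/ler_addgt0Pl => e e0; rewrite addr0.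
have := le_eps (e / (2 * `|y - x|)); rewrite divr_gt0 ?mulr_gt0// => /(_ isT).
suff -> : 2 * (e / (2 * `|y - x|)) * `|y - x| = e by [].
by field; rewrite gt_eqF.
Qed.

(* [S] may have empty interior, so that gradients are not unique; a component
   orthogonal to [S] does not affect the projection. *)
Lemma projected_gradient_unique S (f : 'rV[R]_d -> R)
    (gradf gradf' : 'rV[R]_d -> 'rV[R]_d) (eta : R) x :
  convex_set (S : set (convex_lmodType 'rV[R]_d)) -> S x ->
  is_gradient_on S f x (gradf x) -> is_gradient_on S f x (gradf' x) ->
  projected_gradient S gradf eta x = projected_gradient S gradf' eta x.
Proof.
move=> cS Sx fv fw; rewrite /projected_gradient; congr (_ *: (_ - _)).
rewrite /Defs.proj; congr xget; apply/seteqP.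
have dist v w p q : S p -> S q ->
  is_gradient_on S f x v -> is_gradient_on S f x w ->
  enorm (x - eta *: v - p) <= enorm (x - eta *: v - q) ->
  enorm (x - eta *: w - p) <= enorm (x - eta *: w - q).
  move=> Sp Sq fv' fw'.
  (* The term in [dotv a a] is common to all points [b], so [a] affects the comparison of distances
     only through [dotv a (b - x)]. *)
  have distE a b : dotv (x - eta *: a - b) (x - eta *: a - b) =
    dotv (x - b) (x - b) + 2 * eta * dotv a (b - x) + eta ^+ 2 * dotv a a.
    rewrite addrAC -(opprB x b); move: (x - b) => u.
    by rewrite dotvNr dotvBl !dotvBr !(dotvZl, dotvZr) (dotvC u a); ring.
  have vwE b : S b -> dotv w (b - x) = dotv v (b - x).
    move=> Sb; apply/esym/eqP; rewrite -subr_eq0 -dotvBl.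
    by rewrite (is_gradient_on_orthogonal S f x).
  by rewrite !le_enorm !distE !vwE//; lra.
by split=> p [Sp pmin]; split=> // y Sy; apply: dist (pmin _ Sy).
Qed.

End euclidean_lemmas.

(** * Almost sure bounds from conditional moments *)

Section probability_lemmas.
Context {R : realType} {dO : measure_display} {Omega : measurableType dO}.
Import HBNNSimple.
Variable P : probability Omega R.

(** With A = {c < s Z}, the chain is 2 c^2 P(A) <= 2 c s E[Z; A] = 2 c s E[Y; A] <= E[W; A] + c^2
    P(A) = E[M; A] + c^2 P(A) <= (G + c^2) P(A), which forces P(A) = 0. *)
Lemma cond_exp_ae_le F (Y Z W M : Omega -> R) (s c G : R) :
  is_cond_exp P F Y Z -> is_cond_exp P F W M -> (forall w, Y w ^+ 2 <= W w) ->
  {ae P, forall w, M w <= G} -> s ^+ 2 = 1 -> 0 <= c -> G < c ^+ 2 ->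
  {ae P, forall w, s * Z w <= c}.
Proof.
move=> [iY iZ FZ YZ] [iW iM _ WM] YW [N [mN PN0 MN]] s1 c0 Gc.
pose B : set R := [set z | c < s * z].
have mB : measurable B.
  rewrite (_ : B = ( *%R s) @^-1` `]c, +oo[%classic); last first.
    by apply/seteqP; split=> z /=; rewrite in_itv/= andbT.
  rewrite -[_ @^-1` _]setTI.
  by apply: mulrl_measurable.
pose A := Z @^-1` B.
have mA : measurable A.
  have /measurable_int/measurable_EFinP mZ := iZ.
  by rewrite -[A]setTI; exact: mZ.
have FA : F A by exact: FZ.
have iA f : P.-integrable setT (EFin \o f) -> P.-integrable A (EFin \o f).
  by apply: integrableS.
have iAc (a : R) : P.-integrable A (EFin \o cst a).
  by apply: iA; apply: finite_measure_integrable_cst.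
have iAZ f (a : R) : P.-integrable A (EFin \o f) ->
    P.-integrable A (EFin \o (fun w => a * f w)).
  by move=> iAf; exact: (integrableZl mA a iAf).
have lower : 2 * c ^+ 2 * fine (P A) <= 2 * c * s * \int[P]_(w in A) Z w.
  rewrite -RintegralZl//; last exact: iA.
  rewrite -Rintegral_cst//; apply: le_Rintegral => //.
  - exact: iAc.
  - by apply: iAZ; exact: iA.
  move=> w; rewrite /A /B /= => cZ.
  rewrite expr2 -!mulrA ler_pM2l//; apply: ler_wpM2l => //; exact: ltW.
have upper : 2 * c * s * \int[P]_(w in A) Y w <=
    \int[P]_(w in A) W w + c ^+ 2 * fine (P A).
  rewrite -RintegralZl//; last exact: iA.
  rewrite -Rintegral_cst// -RintegralD//; [|exact: iA|exact: iAc].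
  apply: le_Rintegral => //.
  - by apply: iAZ; exact: iA.
  - exact: (integrableD mA (iA _ iW) (iAc (c ^+ 2))).
  (* AM-GM: [2 c (s Y) <= c ^+ 2 + Y ^+ 2] *)
  - move=> w _; have := sqr_ge0 (s * Y w - c); have := YW w.
    by rewrite sqrrB exprMn s1; lra.
have M_le : \int[P]_(w in A) M w <= G * fine (P A).
  (* The bound on [M] holds only off the null set [N], which is therefore removed from both domains
     of integration. *)
  have ieq f : P.-integrable A (EFin \o f) ->
      \int[P]_(w in A) f w = \int[P]_(w in A `\` N) f w.
    by move=> iAf; congr fine; exact: negligible_integral.
  have iAN f : P.-integrable A (EFin \o f) ->
      P.-integrable (A `\` N) (EFin \o f).
    by apply: integrableS => //; exact: measurableD.
  rewrite -Rintegral_cst// ieq ?(ieq (cst G))//; last exact: iA.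
  apply: le_Rintegral => //; [exact: measurableD|exact/iAN/iA|exact: iAN|].
  by move=> w [_ Nw]; apply: contrapT => /MN.
have YZA : \int[P]_(w in A) Z w = \int[P]_(w in A) Y w.
  by congr fine; exact: YZ.
have WMA : \int[P]_(w in A) M w = \int[P]_(w in A) W w.
  by congr fine; exact: WM.
have PA0 : fine (P A) = 0.
  apply/eqP; rewrite eq_le fine_ge0// andbT.
  rewrite -(pmulr_rle0 _ (_ : 0 < c ^+ 2 - G)) ?subr_gt0//.
  by move: lower upper M_le; rewrite YZA WMA; lra.
exists A; split => //.
  by rewrite -(fineK (fin_num_measure P A mA)) PA0.
by move=> w /= /negP; rewrite -ltNge.
Qed.

Lemma cond_exp_ae_sqr_le F (Y Z W M : Omega -> R) (G : R) :
  is_cond_exp P F Y Z -> is_cond_exp P F W M -> (forall w, Y w ^+ 2 <= W w) ->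
  {ae P, forall w, M w <= G} -> 0 <= G ->
  {ae P, forall w, Z w ^+ 2 <= (1 + G) ^+ 2}.
Proof.
move=> YZ WM YW MG G0.
(* The threshold [1 + G] has a square above [G] without recourse to a square root. *)
have Gc : G < (1 + G) ^+ 2 by nra.
have c0 : 0 <= 1 + G by lra.
have bound s : s ^+ 2 = 1 -> {ae P, forall w, s * Z w <= 1 + G}.
  by move=> s1; exact: (cond_exp_ae_le F Y Z W M s (1 + G) G).
have := bound (-1); rewrite sqrrN expr1n => /(_ erefl).
apply: filterS2 (bound 1 (expr1n _ _)) => w; rewrite mulN1r mul1r => Zp ZN.
by nra.
Qed.

(* [X] need not be measurable: the integral of a nonnegative function is a
   supremum over the simple functions below it. *)
Lemma expectation_ae_le (X : Omega -> R) (c : R) :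
  (forall w, 0 <= X w) -> 0 <= c -> {ae P, forall w, X w <= c} ->
  ('E_P[X] <= c%:E)%E.
Proof.
move=> X0 c0 Xc; rewrite unlock ge0_integralTE => [|w]; last by rewrite lee_fin.
apply: ge_ereal_sup => _ [h /= hX <-].
rewrite -integralT_nnsfun.
have -> : c%:E = (\int[P]_w (cst c%:E w))%E.
  by rewrite integral_cst// -[LHS]mule1; congr mule;
    exact: (esym (probability_setT P)).
apply: ae_ge0_le_integral => //.
- by move=> w _; rewrite lee_fin; exact: fun_ge0.
- exact/measurable_EFinP.
- apply: filterS Xc => w Xwc _.
  by rewrite (le_trans (hX w))// lee_fin.
Qed.

End probability_lemmas.

(** A single inequality in the extended reals yields both halves of [ebigO]: finiteness and the
    bound on [fine]. *)
Lemma ebigO_le {R : realType} (u : nat -> \bar R) (v : nat -> R) (k : R) :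
  0 < k -> (forall T, 0 <= u T)%E ->
  (\forall T \near \oo, (u T <= (k * v T)%:E)%E) -> ebigO u v.
Proof.
move=> k0 u0 uv.
have u_fin : \forall T \near \oo, u T \is a fin_num.
  by apply: filterS uv => T uT; rewrite ge0_fin_numE// (le_lt_trans uT)// ltry.
split => //; apply/eqO_exP; exists k => //.
apply: filterS2 uv u_fin => T uT fT /=.
rewrite ger0_norm ?fine_ge0// -lee_fin fineK// (le_trans uT)// lee_fin.
by rewrite ler_pM2l// ler_norm.
Qed.

(** * Expected size of the projected gradient along the iterates *)

Section projected_sgd.
Context {R : realType} {d n : nat}.
Context {dO : measure_display} {Omega : measurableType dO}.
Context {dX : measure_display} {Xi : measurableType dX}.
Variables (P : probability Omega R) (S : set 'rV[R]_d).
Hypothesis S_closed : closed S.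

Lemma iterate_in (x0 : 'rV[R]_d) (eta : nat -> R)
    (g : 'I_n -> 'rV[R]_d -> Xi -> 'rV[R]_d) (x : nat -> Omega -> 'rV[R]_d)
    (xi : nat -> Omega -> Xi) (tau : 'I_n -> nat -> Omega -> int) :
  delayed_projected_sgd P S x0 eta g x xi tau -> forall t w, S (x t w).
Proof.
move=> [_ _ _ _ _ [Sx0 x0E] step] [|t] w; first by rewrite x0E.
by rewrite step; apply: (proj_spec S _ S_closed _).1; exists x0.
Qed.

Hypothesis S_convex : convex_set (S : set (convex_lmodType 'rV[R]_d)).

(** In the constant, 8 is 4 from [projected_gradient_le] times 2 from splitting each [gradfi] around
    [gtilde]; [n ^ 2] comes from the square of a sum of [n] equally bounded terms, and [d] counts
    coordinates of [gtilde]. *)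
Lemma expected_projected_gradient_le (f : 'I_n -> 'rV[R]_d -> R)
    (gradfi : 'I_n -> 'rV[R]_d -> 'rV[R]_d) (gradf : 'rV[R]_d -> 'rV[R]_d)
    (L G : R) (q eta : nat -> R) (g : 'I_n -> 'rV[R]_d -> Xi -> 'rV[R]_d)
    (x : nat -> Omega -> 'rV[R]_d) (xi : nat -> Omega -> Xi)
    (gtilde : 'I_n -> nat -> Omega -> 'rV[R]_d) (m : 'I_n -> nat -> Omega -> R)
    (t : nat) :
  0 < eta t -> (forall w, S (x t w)) ->
  objective_assumption S f gradfi gradf L ->
  estimator_assumption P g x xi gtilde m gradfi L G q ->
  ('E_P[fun w =>
     (enorm (projected_gradient S gradf (eta t) (x t w)) ^+ 2)%R] <=
   (8 * n%:R ^+ 2 * (d%:R * (1 + G) ^+ 2 + q t ^+ 2))%:E)%E.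
Proof.
move=> eta0 Sx [_ gradf_grad _ gradfi_grad _].
move=> [mean second_moment G0 mG _ q0 bias].
have gtilde_le : {ae P, forall w, forall i j,
    gtilde i t w ord0 j ^+ 2 <= (1 + G) ^+ 2}.
  apply: filter_forall => i; apply: filter_forall => j.
  apply: (cond_exp_ae_sqr_le P _ _ _ _ _ _ (mean i t j) (second_moment i t)).
  - by move=> w; rewrite sqr_enorm sqr_coord_le.
  - exact: mG.
  - exact: ltW.
have bias_le : {ae P, forall w, forall i,
    enorm (gtilde i t w - gradfi i (x t w)) <= q t}.
  by apply: filter_forall => i; exact: bias.
apply: expectation_ae_le => [w||].
- exact: sqr_ge0.
- by rewrite !mulr_ge0 ?addr_ge0 ?sqr_ge0// mulr_ge0 ?ler0n ?sqr_ge0.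
apply: filterS2 gtilde_le bias_le => w gtilde_le bias_le.
(* The bias condition controls the [gradfi], and their sum is a gradient of the same function as
   [gradf], hence gives the same projected gradient. *)
rewrite (projected_gradient_unique S (fun z => \sum_i f i z) gradf
  (fun z => \sum_i gradfi i z)) //; last first.
- by apply: is_gradient_on_sum => i; exact: gradfi_grad.
- exact: gradf_grad.
apply: le_trans (projected_gradient_le _ _ _ _ S_closed (Sx w) eta0) _.
have gradfi_le i : dotv (gradfi i (x t w)) (gradfi i (x t w)) <=
    2 * (d%:R * (1 + G) ^+ 2 + q t ^+ 2).
  rewrite -[X in dotv X X](subrK (gtilde i t w)).
  apply: le_trans (dotvvD_le _ _) _.
  rewrite mulrDr addrC; apply: lerD; rewrite ler_pM2l//.
    rewrite mulr_natl -[X in _ *+ X]card_ord -sumr_const.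
    by apply: ler_sum => j _; exact: gtilde_le.
  rewrite -(opprB (gtilde i t w)) dotvNl dotvNr opprK -sqr_enorm.
  by rewrite lerXn2r ?nnegrE ?sqrtr_ge0 ?bias_le.
apply: le_trans (ler_wpM2l _ (dotvv_sum_le _ _)) _ => //.
have sum_le : \sum_i dotv (gradfi i (x t w)) (gradfi i (x t w)) <=
    n%:R * (2 * (d%:R * (1 + G) ^+ 2 + q t ^+ 2)).
  rewrite [leRHS]mulr_natl -[X in _ *+ X]card_ord -sumr_const.
  by apply: ler_sum => i _; exact: gradfi_le.
by have := ler_wpM2l (ler0n R n) sum_le; lra.
Qed.

Lemma mean_sq_projected_gradient_ge0 (gradf : 'rV[R]_d -> 'rV[R]_d)
    (eta : nat -> R) (x : nat -> Omega -> 'rV[R]_d) (T : nat) :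
  (0 <= mean_sq_projected_gradient P S gradf eta x T)%E.
Proof.
rewrite mule_ge0 ?lee_fin ?invr_ge0 ?ler0n// sume_ge0// => t _.
by apply: expectation_ge0 => w; exact: sqr_ge0.
Qed.

Lemma mean_sq_projected_gradient_le (gradf : 'rV[R]_d -> 'rV[R]_d)
    (eta b : nat -> R) (x : nat -> Omega -> 'rV[R]_d) (T : nat) :
  (forall t, 'E_P[fun w =>
     (enorm (projected_gradient S gradf (eta t) (x t w)) ^+ 2)%R] <=
     (b t)%:E)%E ->
  (mean_sq_projected_gradient P S gradf eta x T <=
   (T.+1%:R^-1 * \sum_(0 <= t < T.+1) b t)%:E)%E.
Proof.
move=> Eb; rewrite EFinM lee_wpmul2l ?lee_fin ?invr_ge0 ?ler0n//.
by rewrite -sumEFin; apply: lee_sum => t _; exact: Eb.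
Qed.

End projected_sgd.

(** * Averaging over time and comparison with the step sizes *)

Theorem theorem5 (R : realType) (d n : nat) (n_ge1 : (1 <= n)%N)
  (dO : measure_display) (Omega : measurableType dO) (P : probability Omega R)
  (dX : measure_display) (Xi : measurableType dX)
  (S : set 'rV[R]_d)
  (S_closed : closed S)
  (S_convex : convex_set (S : set (convex_lmodType 'rV[R]_d)))
  (f : 'I_n -> 'rV[R]_d -> R)
  (gradfi : 'I_n -> 'rV[R]_d -> 'rV[R]_d) (gradf : 'rV[R]_d -> 'rV[R]_d)
  (L G C kappa : R) (q eta : nat -> R) (x0 : 'rV[R]_d)
  (g : 'I_n -> 'rV[R]_d -> Xi -> 'rV[R]_d)
  (x : nat -> Omega -> 'rV[R]_d) (xi : nat -> Omega -> Xi)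
  (tau : 'I_n -> nat -> Omega -> int)
  (gtilde : 'I_n -> nat -> Omega -> 'rV[R]_d) (m : 'I_n -> nat -> Omega -> R)
  (eta_pos : forall t, 0 < eta t)
  (process : delayed_projected_sgd P S x0 eta g x xi tau)
  (objective : objective_assumption S f gradfi gradf L)
  (estimator : estimator_assumption P g x xi gtilde m gradfi L G q)
  (delays : delay_assumption P tau C kappa) :
  ((nonincreasing_seq eta ->
    (exists2 etabar : R, 0 < etabar &
       eta `|Num.ceil (kappa * t%:R)|%N / eta t @[t --> \oo] --> etabar) ->
    (\sum_(0 <= t <oo) (eta t)%:E = +oo)%E ->
    ebigO (mean_sq_projected_gradient P S gradf eta x)
      (fun T => (\sum_(0 <= t < T.+1)
                   (eta t + eta t ^+ 2 + eta t * q t ^+ 2))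
                / (T%:R * eta T)))
  /\
   (forall eta0 alpha : R, 0 < eta0 -> 0 < alpha < 1 ->
    (forall t, eta t = eta0 / (t.+1%:R `^ alpha)) ->
    nonincreasing_seq q ->
    ebigO (mean_sq_projected_gradient P S gradf eta x) (fun=> 1))).
Proof.
have Sx := iterate_in P S S_closed _ _ _ _ _ _ process.
(* With a = d (1 + G)^2, the added 1 gives a + q^2 <= (a + 1)(1 + q^2) and keeps [K] positive when
   [d = 0]. *)
set K := 8 * n%:R ^+ 2 * (d%:R * (1 + G) ^+ 2 + 1) : R.
have K0 : 0 < K.
  have n2 : 0 < n%:R ^+ 2 :> R by rewrite exprn_gt0// ltr0n.
  apply: mulr_gt0; first by rewrite mulr_gt0.
  by rewrite ltr_wpDl// mulr_ge0 ?ler0n ?sqr_ge0.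
have E_le t : ('E_P[fun w =>
     (enorm (projected_gradient S gradf (eta t) (x t w)) ^+ 2)%R] <=
    (K * (1 + q t ^+ 2))%:E)%E.
  apply: le_trans (expected_projected_gradient_le P S S_closed S_convex _ _ _
    _ _ _ _ _ _ _ _ _ t (eta_pos t) (Sx t) objective estimator) _.
  rewrite lee_fin /K -[leRHS]mulrA ler_wpM2l//.
  have := mulr_ge0 (ler0n R d) (sqr_ge0 (1 + G)); have := sqr_ge0 (q t); nra.
have mean_le T := mean_sq_projected_gradient_le P S gradf eta _ x T E_le.
split => [eta_decr _ _|eta0 alpha _ _ _ q_decr].
- apply: (ebigO_le _ _ K K0) => [T|].
    exact: mean_sq_projected_gradient_ge0.
  (* At [T = 0] the quotient on the right is a division by zero, with value 0. *)
  exists 1%N => // T /= T_gt0; apply: le_trans (mean_le T) _.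
  rewrite lee_fin -mulr_sumr mulrCA ler_pM2l//.
  have Teta : 0 < T%:R * eta T by rewrite mulr_gt0 ?ltr0n.
  rewrite ler_pdivlMr//.
  have sum_ge0 : 0 <= \sum_(0 <= t < T.+1) (1 + q t ^+ 2).
    by apply: sumr_ge0 => t _; rewrite addr_ge0 ?sqr_ge0.
  (* The discrepancy between the normalisations [T.+1] and [T] only helps, as T / (T + 1) <= 1. *)
  apply: (@le_trans _ _ (eta T * \sum_(0 <= t < T.+1) (1 + q t ^+ 2))).
    move: sum_ge0; move: (\sum_(_ <= _ < _) _) => s s0.
    have -> : T.+1%:R^-1 * s * (T%:R * eta T) = eta T * s * (T%:R / T.+1%:R).
      by ring.
    apply: ler_piMr; first by rewrite mulr_ge0// ltW.
    by rewrite ler_pdivrMr ?ltr0n// mul1r ler_nat.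
  (* Termwise, [eta T <= eta t] for [t <= T], and [eta t ^+ 2] is nonnegative. *)
  rewrite mulr_sumr !big_nat; apply: ler_sum => t /andP[_ tT].
  have := eta_decr _ _ (tT : (t <= T)%N); have := eta_pos t.
  by have := sqr_ge0 (q t); nra.
(* A nonincreasing [q] stays below [q 0], so each expectation, and with it the average, is at most
   this constant. *)
- apply: (ebigO_le _ _ (K * (1 + q 0%N ^+ 2))) => [|T|].
  + by rewrite mulr_gt0// ltr_pwDl// sqr_ge0.
  + exact: mean_sq_projected_gradient_ge0.
  apply: nearW => T; apply: le_trans (mean_le T) _.
  rewrite lee_fin mulr1 ler_pdivrMl ?ltr0n//.
  rewrite mulr_natl -{2}(subn0 T.+1) -sumr_const_nat; apply: ler_sum => t _.
  rewrite ler_pM2l// lerD2l lerXn2r ?nnegrE ?(est_bias_ge0 estimator)//.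
  exact: q_decr.
Qed.
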